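(* For any Veltman model $\mathcal{M}=\langle\mathcal{F},ev\rangle$, its ultrafilter extension $\mathcal{M}^{ue}$ is modally saturated. That is, for every world $a$ of $\mathcal{M}^{ue}$ and every set $\Sigma$ of formulas, the following holds: if for every finite $\Sigma'\subseteq\Sigma$ we have $\mathcal{M}^{ue},a\Vdash\Diamond\bigwedge\Sigma'$, then there is a world $b$ with $aR^{ue}b$ and $\mathcal{M}^{ue},b\Vdash\psi$ for all $\psi\in\Sigma$.
   Context: Formulas: $\alpha ::= p\mid\bot\mid\alpha\to\alpha\mid\Box\alpha\mid\alpha\triangleright\alpha$, with $\Diamond\alpha:=\neg\Box\neg\alpha$. A Veltman frame is $\langle W,R,\{S_w\}_{w\in W}\rangle$ where: - $W$ is nonempty. - $R$ is transitive and conversely well-founded. - Each $S_w$ is a reflexive transitive relation on $R[w]=\{v:wRv\}$ such that $uRv$ implies $uS_wv$ for $u,v\in R[w]$. A Veltman model adds a valuation $ev$ of atoms. Forcing: - $w\Vdash p$ iff $w\in ev(p)$. - $\bot$ is never forced; $\to$ is classical. - $w\Vdash\Box\alpha$ iff all $R$-successors force $\alpha$. - $w\Vdash\alpha\triangleright\beta$ iff for every $u$ with $wRu$ and $u\Vdash\alpha$ there is $v$ with $uS_wv$ and $v\Vdash\beta$. The same clauses are used for the ultrafilter extension. Notation for $X,Y\subseteq W$: - $\overline{Y}=W\setminus Y$. - $\widehat{R^{-1}}(Y)=\{x:\forall y(xRy\to y\in Y)\}$. - $S^{-1}(X,Y)=\{w:\forall x\in X(wRx\to\exists y\in Y\,xS_wy)\}$.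 $U(W)$ is the set of ultrafilters on $W$. For $l\subseteq\wp(W)\setminus\{\emptyset\}$ with the finite intersection property and $f,g\in U(W)$, write $f\prec_l g$ iff the following holds: for every $A\subseteq W$ and every finite (possibly empty) family $S_1,\dots,S_n\in l$, if $S^{-1}(\overline{A},\overline{S_1}\cup\dots\cup\overline{S_n})\in f$ then $A,\widehat{R^{-1}}(A)\in g$. Ultrafilter extension: - $W^{ue}$ is the smallest set of pairs $\langle f,\sigma\rangle$ ($f\in U(W)$, $\sigma$ a finite sequence of labels) containing $\langle f,\langle\rangle\rangle$ for all $f\in U(W)$, and containing $\langle g,\sigma^\frown\langle l\rangle\rangle$ whenever $\langle f,\sigma\rangle\in W^{ue}$ and $f\prec_l g$. - $R^{ue}$ is the transitive closure of $R^{ue}_{one}$, where $\langle f,\sigma\rangle R^{ue}_{one}\langle g,\sigma^\frown\langle l\rangle\rangle$ iff $f\prec_l g$. - $S^{ue}_{\langle f,\sigma\rangle}$ is the smallest reflexive transitive relation on $R^{ue}[\langle f,\sigma\rangle]$ that contains $R^{ue}\cap R^{ue}[\langle f,\sigma\rangle]^2$ and contains every pair $(\langle g,\tau\rangle,\langle h,\tau'\rangle)$ of $R^{ue}$-successors of $\langle f,\sigma\rangle$ whose entries immediately following the initial segment $\sigma$ coincide. - $ev^{ue}(p)=\{\langle f,\sigma\rangle\in W^{ue}: ev(p)\in f\}$. $\mathcal{M}^{ue}=\langle W^{ue},R^{ue},\{S^{ue}\},ev^{ue}\rangle$. *)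

(* Defs.v *)
From Stdlib Require List.
From Stdlib Require Import Relation_Operators.
From mathcomp Require Import all_boot.
From mathcomp Require Import boolp classical_sets cardinality filter.

Set Implicit Arguments.
Unset Strict Implicit.
Unset Printing Implicit Defensive.

Local Open Scope classical_set_scope.

Inductive formula (P : Type) : Type :=
| Var of P
| Bot
| Imp of formula P & formula P
| Box of formula P
| Rhd of formula P & formula P.

Arguments Bot {P}.

Definition Neg P (a : formula P) : formula P := Imp a Bot.
Definition Top {P} : formula P := Neg Bot.
Definition And P (a b : formula P) : formula P := Neg (Imp a (Neg b)).
Definition Dia P (a : formula P) : formula P := Neg (Box (Neg a)).
Definition BigAnd P (s : seq (formula P)) : formula P := foldr (@And P) Top s.

(* Bare relational data: forcing must also make sense on the ultrafilter
   extension, whose accessibility relation need not be conversely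
   well-founded.  [relS w u v] reads u S_w v. *)
Record frame : Type := Frame {
  world :> Type;
  relR : world -> world -> Prop;
  relS : world -> world -> world -> Prop
}.

Record is_veltman_frame (F : frame) : Prop := IsVeltmanFrame {
  veltman_inhabited : inhabited F;
  veltman_R_trans : forall x y z : F, relR x y -> relR y z -> relR x z;
  veltman_R_cwf : well_founded (fun x y : F => relR y x);
  veltman_S_dom : forall w u v : F, relS w u v -> relR w u /\ relR w v;
  veltman_S_refl : forall w u : F, relR w u -> relS w u u;
  veltman_S_trans : forall w x y z : F, relS w x y -> relS w y z -> relS w x z;
  veltman_S_R : forall w u v : F, relR w u -> relR w v -> relR u v -> relS w u v
}.

Record model (P : Type) : Type := Model {
  model_frame :> frame;
  ev : P -> set model_frame
}.

Definition is_veltman_model P (M : model P) : Prop := is_veltman_frame M.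

Fixpoint forces P (M : model P) (w : M) (a : formula P) : Prop :=
  match a with
  | Var p => ev p w
  | Bot => False
  | Imp b c => forces w b -> forces w c
  | Box b => forall u : M, relR w u -> forces u b
  | Rhd b c => forall u : M, relR w u -> forces u b ->
      exists v : M, relS w u v /\ forces v c
  end.

Definition modally_saturated P (M : model P) : Prop :=
  forall (a : M) (Sigma : set (formula P)),
    (forall s : seq (formula P),
       (forall psi, List.In psi s -> Sigma psi) -> forces a (Dia (BigAnd s))) ->
    exists b : M, relR a b /\ forall psi, Sigma psi -> forces b psi.

Section UltrafilterExtension.
Variable F : frame.

Definition Rinv_hat (Y : set F) : set F :=
  [set x | forall y, relR x y -> Y y].

Definition Sinv (X Y : set F) : set F :=
  [set w | forall x, X x -> relR w x -> exists2 y, Y y & relS w x y].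

Record ultra : Type := Ultra {
  ultra_sets : set_system F;
  ultraP : UltraFilter ultra_sets
}.

Record label : Type := Label {
  label_sets :> set_system F;
  label_nonempty : ~ label_sets set0;
  label_fip : finI label_sets id
}.

Definition prec (l : label) (f g : ultra) : Prop :=
  forall (A : set F) (D : set (set F)), finite_set D -> D `<=` l ->
    ultra_sets f (Sinv (~` A) (\bigcup_(X in D) ~` X)) ->
    ultra_sets g A /\ ultra_sets g (Rinv_hat A).

Inductive in_ue : ultra -> seq label -> Prop :=
| in_ue_nil f : in_ue f [::]
| in_ue_rcons f s l g : in_ue f s -> prec l f g -> in_ue g (rcons s l).

Record ue_world : Type := UeWorld {
  ue_ultra : ultra;
  ue_seq : seq label;
  ue_worldP : in_ue ue_ultra ue_seq
}.

Definition ue_Rone (a b : ue_world) : Prop :=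
  exists l : label,
    ue_seq b = rcons (ue_seq a) l /\ prec l (ue_ultra a) (ue_ultra b).

Definition ue_R : ue_world -> ue_world -> Prop := clos_trans ue_world ue_Rone.

Inductive ue_S (a : ue_world) : ue_world -> ue_world -> Prop :=
| ue_S_refl b : ue_R a b -> ue_S a b b
| ue_S_trans b c d : ue_S a b c -> ue_S a c d -> ue_S a b d
| ue_S_R b c : ue_R a b -> ue_R a c -> ue_R b c -> ue_S a b c
| ue_S_label b c (l : label) (t t' : seq label) :
    ue_R a b -> ue_R a c ->
    ue_seq b = ue_seq a ++ l :: t -> ue_seq c = ue_seq a ++ l :: t' ->
    ue_S a b c.

Definition ue_frame : frame := Frame ue_R ue_S.

End UltrafilterExtension.

Definition ue_model P (M : model P) : model P :=
  @Model P (ue_frame M) (fun p => [set a | ultra_sets (ue_ultra a) (ev p)]).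

(* Main.v *)
(** The sets that [prec l f g] forces into [g] form a filter [assured l f], and
    on a Veltman frame [prec l f g] just says that [g] extends this filter, so
    any filter meeting [assured l f] is contained in an ultrafilter [g] with
    [prec l f g].  Moreover [assured l f] is contained in the ultrafilter of
    every world reached from [<f, s>] through the label [l], in however many
    steps.  It follows that [stone A], the set of worlds whose ultrafilter
    contains [A], commutes with the Boolean operations, with [Rinv_hat] (use the
    empty label) and with [Sinv] (if [Sinv A B] is not in [f], the label
    [{~` B}] yields a world of [stone A] from which [stone B] cannot be
    reached); hence [stone] maps truth sets to truth sets.  Saturation is then
    the extension property for the empty label and the filter generated by the
    truth sets of finite conjunctions. *)
Require Import Defs.
From Stdlib Require List.
From Stdlib Require Import Relation_Operators.
From mathcomp Require Import all_boot.
From mathcomp Require Import boolp classical_sets cardinality filter.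

Set Implicit Arguments.
Unset Strict Implicit.
Unset Printing Implicit Defensive.

Local Open Scope classical_set_scope.

#[local] Existing Instance ultraP.

Lemma meets_filter_from (T I : Type) (F : set_system T) (D : set I)
    (B : I -> set T) :
  Filter F -> (forall i, D i -> ~ F (~` B i)) -> F `#` filter_from D B.
Proof.
move=> FF FB A C FA [i Di BC]; apply/set0P/eqP => /disjoints_subset AC.
by apply: (FB i Di); apply: filterS FA; apply: subset_trans AC (subsetC BC).
Qed.

Lemma ultrafilter_meets (T : Type) (F G : set_system T) :
  Filter F -> Filter G -> F `#` G ->
  exists U, [/\ UltraFilter U, F `<=` U & G `<=` U].
Proof.
move=> FF FG meetsFG.
pose H := filter_from (F `*` G) (fun AB => AB.1 `&` AB.2).
have HF : Filter H.
  apply: filter_from_filter.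
    by exists (setT, setT); split; apply: filterT.
  move=> [A B] [A' B'] [/= FA GB] [/= FA' GB']; exists (A `&` A', B `&` B').
    by split; apply: filterI.
  by move=> x [[? ?] [? ?]].
have [|U [ultraU HU]] := @ultraFilterLemma _ H.
  by apply: filter_from_proper => -[A B] [/= FA GB]; apply: meetsFG.
exists U; split=> // A FGA; apply: HU.
  by exists (A, setT) => [|x []//]; split=> //; apply: filterT.
by exists (setT, A) => [|x []//]; split=> //; apply: filterT.
Qed.

Section Operators.
Variable F : frame.
Implicit Types A B C X Y : set F.

Lemma Sinv_set0 A : Sinv A set0 = Rinv_hat (~` A).
Proof.
apply/seteqP; split=> w wA x; first by move=> wx Ax; case: (wA x Ax wx).
by move=> Ax wx; case: (wA x wx Ax).
Qed.

Lemma SinvS A B X Y : A `<=` B -> X `<=` Y -> Sinv B X `<=` Sinv A Y.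
Proof.
move=> AB XY w wBX x Ax wx.
by have [y Xy xy] := wBX x (AB _ Ax) wx; exists y => //; apply: XY.
Qed.

Lemma Sinv_setU A B X : Sinv (A `|` B) X = Sinv A X `&` Sinv B X.
Proof.
apply/seteqP; split=> [w wABX|w [wAX wBX] x [Ax|Bx] wx].
- by split=> x ?; apply: wABX; [left|right].
- exact: wAX.
- exact: wBX.
Qed.

Hypothesis hF : is_veltman_frame F.

Lemma Sinv_id A : Sinv A A = setT.
Proof.
by rewrite -subTset => w _ x Ax wx; exists x => //; apply: veltman_S_refl.
Qed.

Lemma Sinv_trans A B C : Sinv A B `&` Sinv B C `<=` Sinv A C.
Proof.
move=> w [wAB wBC] x Ax wx.
have [y By xy] := wAB x Ax wx.
have [z Cz yz] := wBC y By (veltman_S_dom hF xy).2.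
by exists z => //; apply: veltman_S_trans xy yz.
Qed.

Lemma Sinv_setC_boxdot A Y : Sinv (~` A) Y `<=` Sinv (~` (A `&` Rinv_hat A)) Y.
Proof.
move=> w wAY x nAx wx; have [Ax|/wAY/(_ wx)//] := pselect (A x).
have /existsNP[z /not_implyP[xz nAz]] : ~ Rinv_hat A x.
  by move=> RAx; apply: nAx.
have wz := veltman_R_trans hF wx xz.
have [y Yy zy] := wAY z nAz wz.
by exists y => //; apply: veltman_S_trans zy => //; apply: veltman_S_R.
Qed.

End Operators.

Lemma exists_label (F : frame) (L : set_system F) :
  \bigcap_(X in L) X !=set0 -> exists l : label F, l = L :> set_system F.
Proof.
move=> [w Lw]; have L0 : ~ L set0 by move=> /Lw.
have fipL : finI L id by move=> D DL; exists w => X /DL; rewrite inE => /Lw.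
by exists (Label L0 fipL).
Qed.

Section Assured.
Variable F : frame.
Implicit Types (A B : set F) (f g : ultra F) (l : label F).

Definition assured l f : set_system F := [set A | exists D : set (set F),
  [/\ finite_set D, D `<=` l &
      ultra_sets f (Sinv (~` A) (\bigcup_(X in D) ~` X))]].

#[global] Instance assured_filter l f : Filter (assured l f).
Proof.
split=> [|A A' [D [finD Dl fA]] [D' [finD' Dl' fA']]|A B AB [D [finD Dl fA]]].
- exists set0; split=> //; apply: filterS filterT => w _ x.
  by rewrite setCT.
- exists (D `|` D'); rewrite finite_setU subUset bigcup_setU setCI Sinv_setU.
  split=> //; apply: filterI; [apply: filterS fA|apply: filterS fA'].
    by apply: SinvS => // x; left.
  by apply: SinvS => // x; right.
- exists D; split=> //; apply: filterS fA.
  by apply: SinvS => //; apply: subsetC.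
Qed.

Lemma assured_bigcup l f A :
  assured l f A -> ultra_sets f (Sinv (~` A) (\bigcup_(X in l) ~` X)).
Proof.
move=> [D [_ Dl fA]]; apply: filterS fA; apply: SinvS => //.
exact: bigcup_subset.
Qed.

Lemma assured_Rinv_hat l f A : ultra_sets f (Rinv_hat A) -> assured l f A.
Proof.
by move=> fA; exists set0; split=> //; rewrite bigcup_set0 Sinv_set0 setCK.
Qed.

Hypothesis hF : is_veltman_frame F.

Lemma assured_label l f : l `<=` assured l f.
Proof.
move=> X lX; exists [set X]; rewrite bigcup_set1 Sinv_id //.
by split=> [|_ ->//|]; [apply: finite_set1|apply: filterT].
Qed.

Lemma assured_boxdot l f A : assured l f A -> assured l f (A `&` Rinv_hat A).
Proof.
move=> [D [finD Dl fA]]; exists D; split=> //.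
by apply: filterS fA; apply: Sinv_setC_boxdot.
Qed.

Lemma assured_Sinv l f A B :
  ultra_sets f (Sinv A B) -> assured l f (~` B) -> assured l f (~` A).
Proof.
rewrite /assured /= !setCK => fAB [D [finD Dl fB]]; exists D.
by split=> //; apply: filterS (filterI fAB fB); apply: Sinv_trans.
Qed.

Lemma precP l f g : prec l f g <-> assured l f `<=` ultra_sets g.
Proof.
split=> [fg A [D [finD Dl fA]]|fg A D finD Dl fA].
  by have [] := fg A D finD Dl fA.
have /assured_boxdot/fg gA : assured l f A by exists D.
by split; apply: filterS gA => x [].
Qed.

End Assured.

Definition stone (F : frame) (A : set F) : set (ue_frame F) :=
  [set a | ultra_sets (ue_ultra a) A].

Section Stone.
Variable F : frame.
Implicit Types (A B : set F) (a b c : ue_frame F) (l : label F).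

Lemma stone_set0 : stone (set0 : set F) = set0.
Proof. by rewrite -subset0 => a; apply: filter_not_empty. Qed.

Lemma stone_setI A B : stone (A `&` B) = stone A `&` stone B.
Proof.
apply/seteqP; split=> [a ABa|a [Aa Ba]]; last exact: filterI.
by split; apply: filterS ABa => x [].
Qed.

Lemma stone_setC A : stone (~` A) = ~` stone A.
Proof.
apply/seteqP; split=> [|a nAa].
  by apply/disjoints_subset; rewrite -stone_setI setICl stone_set0.
by have [] := in_ultra_setVsetC A (ultraP (ue_ultra a)).
Qed.

Lemma stone_setU A B : stone (A `|` B) = stone A `|` stone B.
Proof.
by rewrite -[LHS]setCK -stone_setC setCU stone_setI !stone_setC setCI !setCK.
Qed.

Definition ue_R_via l a b : Prop :=
  relR a b /\ exists t, ue_seq b = ue_seq a ++ l :: t.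

Lemma ue_R_seq a b : relR a b -> exists t, ue_seq b = ue_seq a ++ t.
Proof.
elim=> [x y [l [-> _]]|x y z _ [t ->] _ [t' ->]].
  by exists [:: l]; rewrite cats1.
by exists (t ++ t'); rewrite catA.
Qed.

Lemma ue_S_via l a b c : relS a b c -> ue_R_via l a b -> ue_R_via l a c.
Proof.
elim=> {b c} [//|b c d _ abc _ acd /abc/acd//|b c ab ac bc|
              b c m t t' ab ac bE cE].
  move=> [_ [t bE]]; split=> //.
  have [t' ->] := ue_R_seq bc.
  by exists (t ++ t'); rewrite bE -catA.
move=> [_ [s]]; rewrite bE => /(@List.app_inv_head _ _ _ _)[<- _].
by split=> //; exists t'.
Qed.

Hypothesis hF : is_veltman_frame F.

Lemma ue_R_assured a b : relR a b -> exists2 l, ue_R_via l a b &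
  assured l (ue_ultra a) `<=` ultra_sets (ue_ultra b).
Proof.
elim=> {a b} [a b ab|a b c ab [l [_ [t bE]] lab] bc [l' [_ [t' cE]] lbc]].
  have [l [bE /(precP hF) lab]] := ab; exists l => //.
  by split; [apply: t_step|exists [::]; rewrite cats1].
exists l; first split.
- exact: t_trans ab bc.
- by exists (t ++ l' :: t'); rewrite cE bE -catA.
- move=> A /(assured_boxdot hF)/lab bA; apply/lbc/assured_Rinv_hat.
  by apply: filterS bA => x [].
Qed.

Lemma ue_R_via_assured l a b :
  ue_R_via l a b -> assured l (ue_ultra a) `<=` ultra_sets (ue_ultra b).
Proof.
move=> [/ue_R_assured[m [_ [t' ->]] mab] [t]].
by move=> /(@List.app_inv_head _ _ _ _)[<-].
Qed.

Lemma exists_ue_R_via_filter l a (G : set_system F) :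
  Filter G -> assured l (ue_ultra a) `#` G ->
  exists2 b, ue_R_via l a b & G `<=` ultra_sets (ue_ultra b).
Proof.
move=> FG /ultrafilter_meets[g [ultra_g ag Gg]].
have prec_ag : prec l (ue_ultra a) (Ultra ultra_g) by apply/(precP hF).
exists (UeWorld (in_ue_rcons (ue_worldP a) prec_ag)) => //; split.
  by apply: t_step; exists l.
by exists [::]; rewrite cats1.
Qed.

Lemma exists_ue_R_via l a A : ~ assured l (ue_ultra a) (~` A) ->
  exists2 b, ue_R_via l a b & stone A b.
Proof.
move=> laA.
have [|b ab Ab] := @exists_ue_R_via_filter l a (globally A).
  rewrite meets_globallyr => B lB; apply/set0P/eqP => /disjoints_subset BA.
  by apply: laA; apply: filterS lB.
by exists b => //; apply: Ab.
Qed.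

Lemma exists_label_assured_Rinv_hat : exists l, forall f A,
  assured l f A -> ultra_sets f (Rinv_hat A).
Proof.
have [|l l0] := @exists_label F set0.
  by rewrite bigcap_set0; have [w] := veltman_inhabited hF; exists w.
exists l => f A /assured_bigcup.
by rewrite l0 bigcup_set0 Sinv_set0 setCK.
Qed.

Lemma stone_Rinv_hat A : stone (Rinv_hat A) = Rinv_hat (stone A).
Proof.
apply/seteqP; split=> a.
  by move=> Aa b /ue_R_assured[l _ lab]; apply/lab/assured_Rinv_hat.
move=> aA; have [l lRinv] := exists_label_assured_Rinv_hat.
apply: contrapT => nAa.
have [|b [ab _]] := @exists_ue_R_via l a (~` A).
  by rewrite setCK => /lRinv.
by rewrite stone_setC; apply; apply: aA.
Qed.

Lemma Sinv_stone_sub A B : Sinv (stone A) (stone B) `<=` stone (Sinv A B).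
Proof.
move=> a aAB; apply: contrapT => nABa.
have [|l lB] := @exists_label F [set ~` B].
  rewrite bigcap_set1; apply/set0P/eqP => /(congr1 setC).
  rewrite setCK setC0 => BT; apply: nABa; apply: filterS filterT.
  by rewrite -(Sinv_id hF A) BT; apply: SinvS.
have [|b [ab bt] Ab] := @exists_ue_R_via l a A.
  by move=> /assured_bigcup; rewrite lB bigcup_set1 !setCK.
have [c Bc abc] := aAB b Ab ab.
suff : stone (~` B) c by rewrite stone_setC.
apply: (ue_R_via_assured (ue_S_via abc (conj ab bt))).
by apply: assured_label => //; rewrite lB.
Qed.

Lemma stone_Sinv A B : stone (Sinv A B) = Sinv (stone A) (stone B).
Proof.
apply/seteqP; split; last exact: Sinv_stone_sub.
move=> a ABa b Ab ab; have [l [_ [t bE]] lab] := ue_R_assured ab.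
have [|c [ac [t' cE]] Bc] := @exists_ue_R_via l a B.
  move=> /(assured_Sinv hF ABa)/lab nAb.
  by have : stone (~` A) b by []; rewrite stone_setC.
by exists c => //; apply: ue_S_label bE cE.
Qed.

End Stone.

Definition truth_set P (M : model P) (phi : formula P) : set M :=
  [set w | forces w phi].
Arguments truth_set {P} M phi.

Section TruthSet.
Variables (P : Type) (M : model P).
Implicit Types phi psi : formula P.

Lemma truth_set_Bot : truth_set M Bot = set0.
Proof. by []. Qed.

Lemma truth_set_Imp phi psi :
  truth_set M (Imp phi psi) = ~` truth_set M phi `|` truth_set M psi.
Proof. by apply/funext => w; apply: implyE. Qed.

Lemma truth_set_Box phi : truth_set M (Box phi) = Rinv_hat (truth_set M phi).
Proof. by []. Qed.

Lemma truth_set_Rhd phi psi :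
  truth_set M (Rhd phi psi) = Sinv (truth_set M phi) (truth_set M psi).
Proof.
apply/seteqP; split=> w wphi u.
  by move=> uphi wu; have [v []] := wphi u wu uphi; exists v.
by move=> wu uphi; have [v] := wphi u uphi wu; exists v.
Qed.

Lemma truth_set_Neg phi : truth_set M (Neg phi) = ~` truth_set M phi.
Proof. by rewrite truth_set_Imp truth_set_Bot setU0. Qed.

Lemma truth_set_And phi psi :
  truth_set M (And phi psi) = truth_set M phi `&` truth_set M psi.
Proof. by rewrite truth_set_Neg truth_set_Imp setCU truth_set_Neg !setCK. Qed.

Lemma truth_set_BigAnd_nil : truth_set M (BigAnd [::]) = setT.
Proof. by rewrite truth_set_Neg truth_set_Bot setC0. Qed.

Lemma truth_set_BigAnd_cons phi (s : seq (formula P)) :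
  truth_set M (BigAnd (phi :: s)) = truth_set M phi `&` truth_set M (BigAnd s).
Proof. exact: truth_set_And. Qed.

Lemma truth_set_BigAnd_cat (s t : seq (formula P)) :
  truth_set M (BigAnd (s ++ t)) =
  truth_set M (BigAnd s) `&` truth_set M (BigAnd t).
Proof.
elim: s => [|phi s IHs]; first by rewrite truth_set_BigAnd_nil setTI.
by rewrite cat_cons !truth_set_BigAnd_cons IHs setIA.
Qed.

Lemma BigAnd_filter (Sigma : set (formula P)) :
  Filter (filter_from [set s | forall psi, List.In psi s -> Sigma psi]
                      (fun s => truth_set M (BigAnd s))).
Proof.
apply: filter_from_filter; first by exists [::].
move=> s t sS tS; exists (s ++ t); last by rewrite truth_set_BigAnd_cat.
by move=> psi /(@List.in_app_or _ _ _ _)[/sS|/tS].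
Qed.

End TruthSet.

Section TruthLemma.
Variables (P : Type) (M : model P) (hM : is_veltman_model M).

Lemma truth_set_ue (phi : formula P) :
  truth_set (ue_model M) phi = stone (truth_set M phi).
Proof.
elim: phi => [p||b IHb c IHc|b IHb|b IHb c IHc].
- by [].
- by rewrite !truth_set_Bot stone_set0.
- by rewrite !truth_set_Imp stone_setU stone_setC -IHb -IHc.
- by rewrite !truth_set_Box (stone_Rinv_hat hM) -IHb.
- by rewrite !truth_set_Rhd (stone_Sinv hM) -IHb -IHc.
Qed.

Lemma forces_ue (phi : formula P) (a : ue_model M) :
  forces a phi <-> ultra_sets (ue_ultra a) (truth_set M phi).
Proof. by rewrite -[forces a phi]/(truth_set _ phi a) truth_set_ue. Qed.

End TruthLemma.

Theorem theorem6p6 (P : Type) (M : model P) (hM : is_veltman_model M) :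
  modally_saturated (ue_model M).
Proof.
move=> a Sigma Sigma_a.
have [l lRinv] := exists_label_assured_Rinv_hat hM.
have [|b [ab _] Sigma_b] :=
    exists_ue_R_via_filter hM (l := l) (a := a) (BigAnd_filter M Sigma).
  apply: meets_filter_from => s sSigma /lRinv.
  rewrite -truth_set_Neg -truth_set_Box => /(forces_ue hM).
  exact: Sigma_a.
exists b; split=> // psi Sigma_psi; apply/(forces_ue hM)/Sigma_b.
exists [:: psi]; first by move=> _ [<-|[]].
by rewrite truth_set_BigAnd_cons => w [].
Qed.
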